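(* Let $\Pi_q$ be a projective plane of order $q$ and let $\mathcal{S}$ be a $t$-semiarc in $\Pi_q$ such that some line meets $\mathcal{S}$ in exactly $q+1-t$ points (a $(q+1-t)$-secant). Then either $t=1$ and $q\leq 3$, or $t\geq \sqrt{q-1}$.
   Context: A non-empty point set $\mathcal{S}$ of a projective plane $\Pi_q$ of order $q$ is a $t$-semiarc if for every point $P\in\mathcal{S}$ there are exactly $t$ lines $\ell$ with $\ell\cap\mathcal{S}=\{P\}$ (the tangents to $\mathcal{S}$ at $P$). A line meeting $\mathcal{S}$ in exactly $k>1$ points is called a $k$-secant of $\mathcal{S}$.
   Formalization: The formal theorem assumes t ≥ 1; for t = 0 the claim fails, since the set of all points of the plane is a 0-semiarc for which every line is a (q+1)-secant, while 0 < √(q−1). *)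

(* Defs.v *)
From mathcomp Require Import all_boot all_order all_algebra.

Set Implicit Arguments.
Unset Strict Implicit.
Unset Printing Implicit Defensive.

Section Planes.
Variables (P L : finType) (I : P -> L -> bool).

Definition points_on (l : L) : {set P} := [set p | I p l].

Record projective_plane : Prop := ProjectivePlane {
  join_unique : forall p p' : P, p != p' -> exists! l : L, I p l /\ I p' l;
  meet_unique : forall l l' : L, l != l' -> exists! p : P, I p l /\ I p l';
  quadrangle : exists A : {set P},
    #|A| = 4 /\ forall l : L, #|points_on l :&: A| <= 2 }.

Definition plane_of_order (q : nat) : Prop :=
  projective_plane /\ forall l : L, #|points_on l| = q + 1.

Definition tangents (S : {set P}) (p : P) : {set L} :=
  [set l | points_on l :&: S == [set p]].

(* t = 0 (a set without tangents) is not excluded by this definition. *)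
Definition semiarc (t : nat) (S : {set P}) : Prop :=
  S != set0 /\ forall p, p \in S -> #|tangents S p| = t.

Definition secant (k : nat) (S : {set P}) (l : L) : Prop :=
  1 < k /\ #|points_on l :&: S| = k.

End Planes.

(* Main.v *)
(* Let l0 be the long secant, U = S :&: l0, T = S minus l0 and k = q - t, so
   that #|U| = k + 1. Every line joining a point of T to a point of l0 outside U
   is a tangent; hence #|T| <= q, and the line through two points of T meets U.
   Through each point of U exactly k lines meet T, so #|T| = k + e with
   0 <= e <= t, and at most (e + 1) e ordered pairs of points of T are collinear
   with a given point of U. Counting all ordered pairs of points of T gives
   (k + e)(k + e - 1) <= (k + 1)(e + 1) e. If t ^ 2 + 1 < q, this leaves only
   t = 1, q <= 3 and the equality case q = 6, t = e = 2. In the case of equality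
   every line meets T in 0, 1 or e + 1 points, so e divides #|T| - 1, whereas 2
   does not divide 5. *)

Require Import Defs.
From mathcomp Require Import all_boot all_order all_algebra.
From mathcomp Require Import zify ring.
Import Order.TTheory GRing.Theory Num.Theory.

Set Implicit Arguments.
Unset Strict Implicit.

(** * Numerical bounds for the pair count *)

Lemma pair_count_bound (k e t : nat) : e <= t -> t ^ 2 + 1 < k + t ->
  (k + e) * (k + e).-1 <= k.+1 * (e.+1 * e) ->
  t <= 1 /\ k + t <= 3 \/ [/\ t = 2, k = 4 & e = 2].
Proof.
move=> et kt count.
(* [c] is the slack in [e * e + 2 <= k + e], which follows from [t = e + d] and [d <= d * d]. *)
have [c kE] : exists c, k + e = e * e + 2 + c.
  suff : e * e + 2 <= k + e by move=> /subnKC <-; exists (k + e - (e * e + 2)).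
  have [d tE] : exists d, t = e + d by exists (t - e); rewrite subnKC.
  have dd : d <= d * d by case: (d) => // d'; rewrite leq_pmulr.
  have sqE : t ^ 2 = e * e + 2 * (e * d) + d * d by rewrite tE; ring.
  lia.
have k2e : k <= 2 * e.
  (* By this identity [count] amounts to [k * c.+1 <= 2 * e]. *)
  have kc : (k + e) * (k + e).-1 + 2 * e = k.+1 * (e.+1 * e) + k * c.+1.
    have -> : (k + e).-1 = e * e + c.+1 by lia.
    have h : k * (k + e) = k * (e * e + 2 + c) by rewrite kE.
    have h' : e * (k + e) = e * (e * e + 2 + c) by rewrite kE.
    nia.
  have : k <= k * c.+1 by rewrite leq_pmulr.
  lia.
(* Now [t ^ 2 + 1 < k + t <= 2 * e + t <= 3 * t]. *)
have t2 : t <= 2.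
  rewrite leqNgt; apply/negP => t3; have : 3 * t <= t ^ 2 by rewrite leq_mul2r t3 orbT.
  lia.
case: (leqP t 1) => t1; [left | right]; first by lia.
have tE : t = 2 by lia.
by rewrite tE in et kt *; split; lia.
Qed.

(** The excesses [(n x).-1] add up to [e], so each [n x] is at most [e.+1]. Equality forces every
    [n x] to be 1 or [e.+1]. *)
Lemma leqif_sum_mul_pred (T : finType) (A : {set T}) (n : T -> nat) (e : nat) :
  (forall x, x \in A -> 0 < n x) ->
  \sum_(x in A) n x = #|A| + e ->
  \sum_(x in A) n x * (n x).-1 <= e.+1 * e
    ?= iff [forall (x | x \in A), n x * (n x).-1 == e.+1 * (n x).-1].
Proof.
move=> n_gt0 sum_n.
have sum_pred : \sum_(x in A) (n x).-1 = e.
  apply/eqP; rewrite -(eqn_add2l #|A|) -sum_n -sum1_card -big_split /=.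
  by apply/eqP/eq_bigr => x /n_gt0; lia.
have -> : e.+1 * e = \sum_(x in A) e.+1 * (n x).-1.
  by rewrite -big_distrr /= sum_pred.
apply: leqif_sum => x xA; split=> //.
rewrite leq_mul2r; apply/orP; right.
have : (n x).-1 <= \sum_(y in A) (n y).-1.
  by rewrite (bigD1 x) //= leq_addr.
by rewrite sum_pred; lia.
Qed.

(** * Incidence counts in a finite projective plane *)

Section ProjectivePlane.
Variables (P L : finType) (I : P -> L -> bool).
Hypothesis planeI : projective_plane I.

Lemma line_eq {x y : P} {l m : L} :
  x != y -> I x l -> I y l -> I x m -> I y m -> l = m.
Proof.
move=> /(join_unique planeI)[z [_ zu]] xl yl xm ym.
by rewrite -(zu l) // -(zu m).
Qed.

Lemma point_eq {l m : L} {x y : P} :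
  l != m -> I x l -> I x m -> I y l -> I y m -> x = y.
Proof.
move=> lm xl xm yl ym; apply/eqP/negPn/negP => xy.
by move: lm; rewrite (line_eq xy xl yl xm ym) eqxx.
Qed.

Lemma card_points_onI (l : L) (X : {set P}) :
  #|points_on I l :&: X| = \sum_(x in X) I x l.
Proof.
rewrite -sum1_card big_mkcond [RHS]big_mkcond /=.
by apply: eq_bigr => x _; rewrite !inE andbC; case: (x \in X) => //; case: (I x l).
Qed.

Lemma sum_join (x y : P) : x != y -> \sum_(l | I x l) I y l = 1.
Proof.
move=> xy; have [l [[xl yl] lu]] := join_unique planeI xy.
rewrite (bigD1 l) //= yl big1 // => m /andP[xm ml].
apply/eqP; rewrite eqb0; apply: contra ml => ym.
by rewrite (lu m).
Qed.

Lemma sum_pencil (x : P) (X : {set P}) :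
  x \notin X -> \sum_(l | I x l) #|points_on I l :&: X| = #|X|.
Proof.
move=> xX; under eq_bigr => l _ do rewrite card_points_onI.
rewrite exchange_big /= -sum1_card; apply: eq_bigr => y yX.
by apply: sum_join; apply: contraNneq xX => ->.
Qed.

Lemma card_meet (l m : L) : l != m -> #|points_on I l :&: points_on I m| = 1.
Proof.
move=> lm; have [x [[xl xm] xu]] := meet_unique planeI lm.
apply/eqP/cards1P; exists x; apply/setP => y; rewrite !inE.
apply/andP/eqP => [[yl ym]|->]; last by [].
by rewrite (xu y).
Qed.

(** Take three points [a], [b], [c] of the quadrangle other than [x]. If [ab] and [ac] both passed
    through [x], they would coincide and contain all three. *)
Lemma line_avoiding (x : P) : exists l : L, ~~ I x l.
Proof.
have [A [A4 A2]] := quadrangle planeI.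
have := cardsD1 x A; rewrite A4 => cA.
have : 2 < #|A :\ x| by move: cA; case: (x \in A); lia.
case/card_gt2P => a [b [c [[aA bA cA'] [ab bc ca]]]].
move: aA bA cA'; rewrite !inE => /andP[ax aA] /andP[_ bA] /andP[_ cA'].
have [l [[al bl] _]] := join_unique planeI ab.
have ac : a != c by rewrite eq_sym.
have [m [[am cm] _]] := join_unique planeI ac.
have [xl|] := boolP (I x l); last by exists l.
exists m; apply/negP => xm.
have lm := line_eq ax al xl am xm; rewrite -{}lm in cm.
suff : 2 < #|points_on I l :&: A| by rewrite ltnNge A2.
by apply/card_gt2P; exists a, b, c; rewrite !inE al bl cm aA bA cA'.
Qed.

(** Projection from [x] matches the lines through [x] with the points of a line [m] that misses
    [x]. *)
Lemma card_pencil (q : nat) (x : P) :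
  (forall l : L, #|points_on I l| = q + 1) -> #|[set l | I x l]| = q + 1.
Proof.
move=> card_line; have [m xm] := line_avoiding x.
rewrite -(card_line m) -(@sum_pencil x) ?inE // -sum1_card.
apply: eq_big => [l|l]; rewrite inE // => xl.
by rewrite card_meet //; apply: contraNneq xm => <-.
Qed.

(** Ordered pairs of distinct points of [T], sorted by the unique line joining them. *)
Lemma sum_lines_mul_pred (T : {set P}) :
  \sum_l #|points_on I l :&: T| * #|points_on I l :&: T|.-1
    = #|T| * #|T|.-1.
Proof.
transitivity (\sum_(x in T) \sum_(l | I x l) #|points_on I l :&: (T :\ x)|).
  rewrite (exchange_big_dep xpredT) //=; apply: eq_bigr => l _.
  rewrite -sum_nat_const; apply: eq_big => [x|x]; rewrite !inE andbC // => xlT.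
  have := cardsD1 x (points_on I l :&: T).
  by rewrite !inE andbC xlT setIDA => ->.
rewrite -sum_nat_const; apply: eq_bigr => x xT.
by rewrite sum_pencil ?setD11 // (cardsD1 x T) xT.
Qed.

End ProjectivePlane.

(** * The points of the semiarc off the long secant *)

Section LongSecant.
Variables (P L : finType) (I : P -> L -> bool) (q t : nat) (S : {set P}).
Variable l0 : L.
Hypothesis planeI : projective_plane I.
Hypothesis card_line : forall l : L, #|points_on I l| = q + 1.
Hypothesis t_gt0 : 0 < t.
Hypothesis card_tangents : forall x, x \in S -> #|tangents I S x| = t.
Hypothesis secant_l0 : secant I (q + 1 - t) S l0.

Let U := points_on I l0 :&: S.
Let T := S :\: points_on I l0.
Let n (l : L) := #|points_on I l :&: T|.
Let k := q - t.

Lemma lt_t_q : t < q.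
Proof. by case: secant_l0; lia. Qed.

Lemma card_U : #|U| = k.+1.
Proof. by case: secant_l0 => _ ->; have := lt_t_q; rewrite /k; lia. Qed.

Lemma n_l0 : n l0 = 0.
Proof.
apply/eqP; rewrite cards_eq0; apply/eqP/setP => x; rewrite !inE.
by case: (I x l0); rewrite //= andbF.
Qed.

Lemma l0_neq (x : P) (l : L) : x \in T -> I x l -> l != l0.
Proof. by rewrite !inE => /andP[xl0 _] xl; apply: contraNneq xl0 => <-. Qed.

Lemma tangentP (x : P) (l : L) : x \in U -> I x l -> l != l0 ->
  (l \in tangents I S x) = (n l == 0).
Proof.
rewrite !inE => /andP[xl0 xS] xl ll0; rewrite cards_eq0; apply/eqP/eqP => h.
  apply/setP => y; rewrite !inE; apply/negP => /and3P[yl yl0 yS].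
  move/setP: h => /(_ y); rewrite !inE yl yS => /esym/eqP yx.
  by rewrite yx xl0 in yl0.
apply/setP => y; rewrite !inE; apply/andP/eqP => [[yl yS]|->]; last by [].
move/setP: h => /(_ y); rewrite !inE yl yS andbT /= => /negbFE yl0.
exact: (point_eq planeI ll0).
Qed.

(** Of the [q] lines through [x] other than [l0], the [t] tangents are exactly those that miss
    [T]. *)
Lemma card_lines_meeting (x : P) : x \in U ->
  #|[set l | I x l & 0 < n l]| = k.
Proof.
move=> xU; have xS : x \in S by move: xU; rewrite inE => /andP[].
have xl0 : I x l0 by move: xU; rewrite !inE => /andP[].
have tan_sub : tangents I S x \subset [set l | I x l] :\ l0.
  apply/subsetP => l; rewrite !inE => /eqP h.
  have -> /= : I x l.
    by have := set11 x; rewrite -h !inE => /andP[].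
  (* [l0] is not a tangent, as it carries [k.+1 > 1] points of [S]. *)
  rewrite andbT; apply/eqP => ll0; have := card_U.
  by rewrite /U -ll0 h cards1; have := lt_t_q; rewrite /k; lia.
have -> : [set l | I x l & 0 < n l] = [set l | I x l] :\ l0 :\: tangents I S x.
  apply/setP => l; rewrite inE [RHS]inE !in_setD1 inE.
  case xl: (I x l); rewrite ?andbF //=.
  have [->|ll0] := eqVneq l l0; first by rewrite n_l0 andbF.
  by rewrite tangentP // lt0n /= andbT.
rewrite cardsDS // card_tangents //.
have := cardsD1 l0 [set l | I x l]; rewrite inE xl0 (card_pencil planeI _ card_line) /=.
by rewrite /k; lia.
Qed.

Lemma sum_n_pencil (x : P) : x \in U ->
  \sum_(l in [set l | I x l & 0 < n l]) n l = #|T|.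
Proof.
move=> xU; rewrite -(sum_pencil planeI (x := x)); last first.
  by move: xU; rewrite !inE => /andP[->].
rewrite [RHS](bigID (fun l => 0 < n l)) /= [X in _ = _ + X]big1 ?addn0.
  by apply: eq_bigl => l; rewrite inE.
by move=> l /andP[_]; rewrite -eqn0Ngt => /eqP.
Qed.

Lemma card_meet_U (l : L) : l != l0 -> #|points_on I l :&: U| <= 1.
Proof.
by move=> ll0; rewrite -(card_meet planeI ll0) subset_leq_card // setIA subsetIl.
Qed.

(* The q + 1 - t lines joining y to U are not tangent, so the t tangents at y
   are exactly the t remaining lines through y. *)
Lemma n_line_missing_U (y : P) (l : L) : y \in T -> I y l ->
  points_on I l :&: U = set0 -> n l = 1.
Proof.
move=> yT yl lU; have yS : y \in S by move: yT; rewrite inE => /andP[].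
have yU : y \notin U by move: yT; rewrite !inE => /andP[/negPf->].
pose B := [set m | I y m & points_on I m :&: U == set0].
have cB : #|B| = t.
  have := sum_pencil planeI yU; rewrite card_U => sU.
  have : #|[set m | I y m] :\: B| = k.+1.
    rewrite -sU -sum1_card big_mkcond [RHS]big_mkcond /=.
    apply: eq_bigr => m _; rewrite !inE.
    case ym: (I y m); rewrite ?andbF //= andbT -cards_eq0.
    have := card_meet_U (l0_neq yT ym).
    by case: #|_| => [|[]].
  rewrite cardsDS ?(card_pencil planeI _ card_line); last first.
    by apply/subsetP => m; rewrite !inE => /andP[].
  have : #|B| <= q + 1.
    rewrite -(card_pencil planeI y card_line) subset_leq_card //.
    by apply/subsetP => m; rewrite !inE => /andP[].
  by have := lt_t_q; rewrite /k; lia.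
have tanB : tangents I S y = B.
  apply/eqP; rewrite eqEcard card_tangents // cB leqnn andbT.
  apply/subsetP => m; rewrite !inE => /eqP h; apply/andP; split.
    by have := set11 y; rewrite -h !inE => /andP[].
  apply/eqP/setP => z; rewrite !inE; apply/negP => /and3P[zm zl0 zS].
  have : z \in [set y] by rewrite -h !inE zm.
  by rewrite inE => /eqP zy; move: yU; rewrite -zy !inE zl0 zS.
have : l \in tangents I S y by rewrite tanB !inE yl lU eqxx.
rewrite inE => /eqP h; rewrite /n.
have -> : points_on I l :&: T = [set y].
  by rewrite setIDA h; apply/setDidPl; rewrite disjoints1; move: yT; rewrite inE => /andP[].
by rewrite cards1.
Qed.

Lemma card_T_le : #|T| <= q.
Proof.
(* [l0] has [t > 0] points outside [U]. Each of the [q] other lines through such a [v] misses [U],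
   hence has at most one point of [T]. *)
have [v] : exists v, v \in points_on I l0 :\: U.
  apply/card_gt0P; rewrite cardsDS ?subsetIl // card_U card_line.
  by have := lt_t_q; rewrite /k; lia.
rewrite inE => /andP[vU]; rewrite inE => vl0.
have vT : v \notin T by rewrite !inE vl0.
rewrite -(sum_pencil planeI vT).
have := card_pencil planeI v card_line.
rewrite (cardsD1 l0) inE vl0 addnC => /addIn <-.
rewrite (bigD1 l0) //= -/(n l0) n_l0 add0n -sum1_card.
rewrite [X in _ <= X](eq_bigl (fun l => I v l && (l != l0))); last first.
  by move=> l; rewrite !inE andbC.
apply: leq_sum => l /andP[vl ll0].
rewrite -/(n l); have [->//|] := posnP (n l).
case/card_gt0P => y; rewrite inE => /andP[]; rewrite inE => yl yT.
rewrite (n_line_missing_U yT yl) //.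
apply/setP => z; rewrite !inE; apply/negP => /and3P[zl zl0 zS].
by move: vU; rewrite (point_eq planeI ll0 vl vl0 zl zl0) !inE zl0 zS.
Qed.

Lemma meet_U (l : L) : 1 < n l -> exists x, x \in U /\ I x l.
Proof.
move=> nl; have /card_gt0P[y] : 0 < n l by lia.
rewrite inE => /andP[]; rewrite inE => yl yT.
have [lU|/set0Pn[x]] := eqVneq (points_on I l :&: U) set0.
  by rewrite (n_line_missing_U yT yl lU) in nl.
by rewrite !inE => /andP[xl xU]; exists x; rewrite !inE.
Qed.

(** A line with at least two points of [T] meets [U] exactly once, so each ordered pair is counted
    at one point of [U]; other lines contribute 0. *)
Lemma sum_over_U :
  \sum_(x in U) \sum_(l in [set l | I x l & 0 < n l]) n l * (n l).-1
    = #|T| * #|T|.-1.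
Proof.
rewrite -(sum_lines_mul_pred planeI) (exchange_big_dep xpredT) //=.
apply: eq_bigr => l _; rewrite -/(n l) sum_nat_const.
have [nl|] := ltnP 1 (n l); last by case: (n l) => [|[]] //; rewrite !muln0.
suff -> : #|[pred x | x \in U & l \in [set l | I x l & 0 < n l]]| = 1 by rewrite mul1n.
transitivity #|points_on I l :&: U|.
  apply: eq_card => x; rewrite !inE.
  by rewrite (ltnW nl) andbT andbC.
have ll0 : l != l0 by apply: contraTneq nl => ->; rewrite n_l0.
have [x [xU xl]] := meet_U nl.
apply/eqP; rewrite eqn_leq card_meet_U //=.
by apply/card_gt0P; exists x; rewrite !inE xl; rewrite !inE in xU.
Qed.

Lemma card_T_ge : k <= #|T|.
Proof.
have /card_gt0P[x xU] : 0 < #|U| by rewrite card_U.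
rewrite -(card_lines_meeting xU) -(sum_n_pencil xU) -sum1_card.
by apply: leq_sum => l; rewrite inE => /andP[].
Qed.

(** The surplus of [T] over the [k] lines that meet it through a point of [U]; by [card_T_ge] the
    subtraction does not truncate. *)
Let e := #|T| - k.

Lemma leqif_pencil (x : P) : x \in U ->
  \sum_(l in [set l | I x l & 0 < n l]) n l * (n l).-1 <= e.+1 * e
    ?= iff [forall (l | l \in [set l | I x l & 0 < n l]),
              n l * (n l).-1 == e.+1 * (n l).-1].
Proof.
move=> xU; apply: leqif_sum_mul_pred.
  by move=> l; rewrite inE => /andP[].
by rewrite sum_n_pencil // card_lines_meeting // subnKC // card_T_ge.
Qed.

Lemma leqif_card_T : #|T| * #|T|.-1 <= k.+1 * (e.+1 * e)
  ?= iff [forall (x | x \in U),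
            [forall (l | l \in [set l | I x l & 0 < n l]),
              n l * (n l).-1 == e.+1 * (n l).-1]].
Proof.
rewrite -sum_over_U -card_U -sum_nat_const.
exact: leqif_sum (fun x xU => leqif_pencil xU).
Qed.

(** The lines through [y] split the rest of [T] into blocks of size [(n l).-1], and equality makes
    each block size 0 or [e]. *)
Lemma dvdn_of_extremal : #|T| * #|T|.-1 = k.+1 * (e.+1 * e) ->
  0 < #|T| -> e %| #|T|.-1.
Proof.
move=> eqT /card_gt0P[y yT].
have := leqif_card_T; rewrite eqT => -[_]; rewrite eqxx => /esym/forall_inP ext.
have <- : #|T :\ y| = #|T|.-1 by rewrite (cardsD1 y T) yT.
rewrite -(sum_pencil planeI (negbT (setD11 y T))).
elim/big_ind: _ => [|a b|l yl]; [by rewrite dvdn0 | exact: dvdn_add |].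
have -> : #|points_on I l :&: (T :\ y)| = (n l).-1.
  by rewrite /n setIDA (cardsD1 y (points_on I l :&: T)) in_setI yT inE yl.
have [nl|] := ltnP 1 (n l); last by case: (n l) => [|[]].
have [x [xU xl]] := meet_U nl.
have /forall_inP/(_ l) := ext x xU; rewrite inE xl (ltnW nl) => /(_ isT).
have n1 : 0 < (n l).-1 by case: (n l) nl => [|[]].
by rewrite eqn_pmul2r // => /eqP ->.
Qed.

Lemma long_secant_bound : (t = 1 /\ q <= 3) \/ q <= t ^ 2 + 1.
Proof.
have [|qt] := leqP q (t ^ 2 + 1); first by right.
have Te : #|T| = k + e by rewrite /e subnKC // card_T_ge.
have kt : k + t = q by rewrite /k subnK // ltnW // lt_t_q.
have et : e <= t by rewrite -(leq_add2l k) -Te kt card_T_le.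
have [count _] := leqif_card_T; rewrite Te in count.
rewrite -kt in qt; have [[t1 kt3]|[t2 k4 e2]] := pair_count_bound et qt count.
  by left; split; [apply/eqP; rewrite eqn_leq t1 | rewrite -kt].
(* Equality holds by computation, [6 * 5 = 5 * (3 * 2)], and would give that 2 divides 5. *)
by have := dvdn_of_extremal; rewrite Te e2 k4 => /(_ erefl isT).
Qed.

End LongSecant.

(** * Passage to the square root *)

Local Open Scope ring_scope.

Theorem theorem2p2 (R : rcfType) (P L : finType) (I : P -> L -> bool)
    (q t : nat) (S : {set P}) :
  plane_of_order I q ->
  (0 < t)%N ->
  semiarc I t S ->
  (exists l : L, secant I (q + 1 - t)%N S l) ->
  (t = 1%N /\ (q <= 3)%N) \/ Num.sqrt (q%:R - 1 : R) <= t%:R.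
Proof.
move=> [planeI card_line] t_gt0 [_ card_tangents] [l0 secant_l0].
have [|qt] := long_secant_bound planeI card_line t_gt0 card_tangents secant_l0.
  by left.
right; have <- : Num.sqrt (t%:R ^+ 2) = t%:R :> R.
  by rewrite sqrtr_sqr ger0_norm ?ler0n.
by rewrite ler_wsqrtr // lerBlDr -natrX -(natrD R _ 1) ler_nat.
Qed.
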